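(* Let $X$ be a complex manifold, $E$ a holomorphic vector bundle over $X$, $\mathcal U=\{U_i\}_{i\in I}$ an open cover of $X$ indexed by an ordered set $I$, and $g=\{g_{ij}\}$ a system of transition functions associated with a certain trivialization of $E$ with respect to $\mathcal U$. For every positive integer $k$ and indices $i_1,\dots,i_{k+1}\in I$ define $t_{i_1\cdots i_{k+1}}\in\Gamma(U_{i_1\cdots i_{k+1}},\Omega^k)$ by $$t_{i_1\cdots i_{k+1}}:=\sum_{\sigma\in S_{k+1}}\frac{\mathrm{sgn}(\sigma)}{(k+1)!}\,\mathrm{tr}\Big(g^{-1}_{i_{\sigma(1)}i_{\sigma(k+1)}}dg_{i_{\sigma(1)}i_{\sigma(k+1)}}\; g^{-1}_{i_{\sigma(2)}i_{\sigma(k+1)}}dg_{i_{\sigma(2)}i_{\sigma(k+1)}}\cdots g^{-1}_{i_{\sigma(k)}i_{\sigma(k+1)}}dg_{i_{\sigma(k)}i_{\sigma(k+1)}}\Big),$$ and define the Čech $k$-cochain $\widehat f_{k,\mathcal U}(E):=(t_{i_1\cdots i_{k+1}})_{i_1<\cdots<i_{k+1}}$ with coefficients in $\Omega^k$. Then $\widehat f_{k,\mathcal U}(E)$ is a Čech $k$-cocycle, and hence defines an element $f_{k,\mathcal U}(E)\in\check H^k(\mathcal U,\Omega^k)$; moreover, $f_{k,\mathcal U}(E)$ is independent of the choice of the system of transition functions $g$ of $E$ with respect to $\mathcal U$.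
   Context: $\Omega^k$ is the sheaf of germs of holomorphic differential $k$-forms on $X$. A trivialization of $E$ (of rank $M$) with respect to $\mathcal U$ is a family of holomorphic bundle isomorphisms $\phi_i:E|_{U_i}\to U_i\times\mathbb C^M$; its system of transition functions consists of the holomorphic maps $g_{ij}:U_i\cap U_j\to GL(M,\mathbb C)$ with $\phi_i\circ\phi_j^{-1}(z,v)=(z,g_{ij}(z)v)$, so $g_{ij}g_{jk}=g_{ik}$. Write $U_{i_1\cdots i_p}=U_{i_1}\cap\cdots\cap U_{i_p}$. $dg_{ij}$ is the entrywise differential of the matrix $g_{ij}$; products are matrix products in which entries are multiplied by the wedge product; $\mathrm{tr}$ is the trace. $S_{k+1}$ is the permutation group of $\{1,\dots,k+1\}$. For a sheaf $\mathcal S$, Čech $k$-cochains with respect to $\mathcal U$ are families $(s_{i_1\cdots i_{k+1}})_{i_1<\cdots<i_{k+1}}$ with $s_{i_1\cdots i_{k+1}}\in\Gamma(U_{i_1\cdots i_{k+1}},\mathcal S)$, with differential $(\partial s)_{i_1\cdots i_{k+2}}=\sum_{j=1}^{k+2}(-1)^{j+1}s_{i_1\cdots\widehat{i_j}\cdots i_{k+2}}|_{U_{i_1\cdots i_{k+2}}}$; $\check H^k(\mathcal U,\mathcal S)$ is the resulting cohomology. *)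

(* Defs.v *)
From HB Require Import structures.
From mathcomp Require Import all_boot all_order all_fingroup all_algebra.
From mathcomp Require Import complex.
From mathcomp Require Import all_classical all_reals topology normedtype derive.

Set Implicit Arguments.
Unset Strict Implicit.
Unset Printing Implicit Defensive.

Import Order.TTheory GRing.Theory Num.Theory.
Import numFieldNormedType.Exports.

Local Open Scope classical_set_scope.
Local Open Scope ring_scope.

(* Throughout, [C] plays the role of the field of complex numbers. The         *)
(* definitions make sense over any [numClosedFieldType]; they are meant to be  *)
(* used with C := R[i] for R : realType.                                       *)

Section Holomorphic.
Variables (C : numClosedFieldType) (V W : normedModType C).

(* [differentiable] is Frechet differentiability with a C-linear differential, *)
(* so [cdifferentiable m D f] says that on the open set D the differentials    *)
(* of f exist and are C-linear up to order m.                                  *)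
Fixpoint cdifferentiable (m : nat) (D : set V) (f : V -> W) : Prop :=
  match m with
  | 0 => forall x, D x -> {for x, continuous f}
  | m'.+1 => (forall x, D x -> differentiable f x) /\
             (forall v, cdifferentiable m' D (fun x => 'd f x v))
  end.

(* For open D: f is of class C^infinity on D and satisfies the Cauchy-Riemann  *)
(* equations (dbar f = 0), the definition of holomorphy used e.g. by Griffiths *)
(* and Harris. Since the partial derivatives of such an f satisfy the same two *)
(* conditions, this amounts to complex differentiability to every order.       *)
Definition holomorphic_on (D : set V) (f : V -> W) : Prop :=
  forall m, cdifferentiable m D f.

End Holomorphic.

(* The functions in a chart are total; only the values of [chart_map] on       *)
(* [chart_dom], and of [chart_inv] on [chart_cod], are meaningful.             *)
Record chart (C : numClosedFieldType) (X : topologicalType)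
    (V : normedModType C) := Chart {
  chart_dom : set X;
  chart_map :> X -> V;
  chart_inv : V -> X
}.

Section Charts.
Variables (C : numClosedFieldType) (X : topologicalType) (V : normedModType C).

Definition chart_cod (c : chart X V) : set V := c @` chart_dom c.

Definition is_chart (c : chart X V) : Prop :=
  [/\ open (chart_dom c),
      open (chart_cod c),
      forall x, chart_dom c x -> chart_inv c (c x) = x,
      forall x, chart_dom c x -> {for x, continuous c}
    & forall y, chart_cod c y -> {for y, continuous (chart_inv c)}].

Definition chart_compatible (c c' : chart X V) : Prop :=
  holomorphic_on (c @` (chart_dom c `&` chart_dom c')) (c' \o chart_inv c).

Definition is_atlas (A : set (chart X V)) : Prop :=
  [/\ forall c, A c -> is_chart c,
      forall x, exists2 c, A c & chart_dom c x
    & forall c c', A c -> A c' -> chart_compatible c c'].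

End Charts.

(* The atlas of a normed space (for instance C^M), and the product atlas on    *)
(* X x W.                                                                      *)
Definition space_atlas (C : numClosedFieldType) (W : normedModType C) :
    set (chart W W) :=
  [set Chart setT id id].

Definition prod_atlas (C : numClosedFieldType) (X : topologicalType)
    (V : normedModType C) (A : set (chart X V)) (W : normedModType C) :
    set (chart (X * W)%type (V * W)%type) :=
  [set Chart (chart_dom c `*` setT) (fun p => (c p.1, p.2))
             (fun q => (chart_inv c q.1, q.2)) | c in A].

Arguments space_atlas {C} W.
Arguments prod_atlas {C X V} A W.

(* Holomorphy, on an open set D, of a map between two spaces with atlases; the *)
(* values of f outside D are irrelevant.                                       *)
Definition holomorphic_map (C : numClosedFieldType) (X Y : topologicalType)
    (V W : normedModType C) (A : set (chart X V)) (B : set (chart Y W))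
    (D : set X) (f : X -> Y) : Prop :=
  (forall x, D x -> {for x, continuous f}) /\
  (forall c d, A c -> B d ->
     holomorphic_on (c @` (chart_dom c `&` (D `&` f @^-1` chart_dom d)))
                    (d \o f \o chart_inv c)).

Record complexManifold (C : numClosedFieldType) (n : nat) := ComplexManifold {
  manifold_space :> topologicalType;
  atlas : set (chart manifold_space 'rV[C]_n);
  manifold_hausdorff : hausdorff_space manifold_space;
  manifold_second_countable : @second_countable manifold_space;
  manifold_atlas : is_atlas atlas
}.
Arguments atlas {C n} _.

Section VectorBundles.
Variables (C : numClosedFieldType) (n : nat) (X : complexManifold C n) (M : nat).

(* The fibre over x is the vector space [bundle_fiber x], identified with      *)
(* p^-1(x) through [bundle_incl x].                                            *)
Record vectorFamily := VectorFamily {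
  bundle_total :> complexManifold C (n + M);
  bundle_proj : bundle_total -> X;
  bundle_fiber : X -> lmodType C;
  bundle_incl : forall x, bundle_fiber x -> bundle_total
}.

(* Holomorphic bundle isomorphisms E|_U -> U x C^M. *)
Record trivialization (E : vectorFamily) (U : set X) := Trivialization {
  triv_map :> E -> X * 'cV[C]_M;
  triv_inv : X * 'cV[C]_M -> E;
  triv_fst : forall e, U (bundle_proj e) -> (triv_map e).1 = bundle_proj e;
  triv_mapK : forall e, U (bundle_proj e) -> triv_inv (triv_map e) = e;
  triv_invK : forall z v, U z ->
    bundle_proj (triv_inv (z, v)) = z /\ triv_map (triv_inv (z, v)) = (z, v);
  triv_linear : forall z, U z -> forall (a : C) (e e' : bundle_fiber E z),
    (triv_map (bundle_incl (a *: e + e'))).2 =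
    a *: (triv_map (bundle_incl e)).2 + (triv_map (bundle_incl e')).2;
  triv_map_holomorphic :
    holomorphic_map (atlas E) (prod_atlas (atlas X) 'cV[C]_M)
      (@bundle_proj E @^-1` U) triv_map;
  triv_inv_holomorphic :
    holomorphic_map (prod_atlas (atlas X) 'cV[C]_M) (atlas E)
      (U `*` setT) triv_inv
}.

Record vectorBundle := VectorBundle {
  bundle_family :> vectorFamily;
  bundle_proj_holomorphic :
    holomorphic_map (atlas bundle_family) (atlas X) setT
      (@bundle_proj bundle_family);
  bundle_incl_inj : forall x, injective (@bundle_incl bundle_family x);
  bundle_incl_range : forall x,
    range (@bundle_incl bundle_family x) =
    @bundle_proj bundle_family @^-1` [set x];
  bundle_locally_trivial : forall x,
    exists2 U, open_nbhs x U & inhabited (trivialization bundle_family U)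
}.

Definition is_open_cover (I : Type) (U : I -> set X) : Prop :=
  (forall i, open (U i)) /\ \bigcup_i U i = setT.

(* g i j is only meaningful on U_i `&` U_j. *)
Definition transition_functions (I : Type) (E : vectorBundle) (U : I -> set X)
    (phi : forall i, trivialization E (U i)) (g : I -> I -> X -> 'M[C]_M) :
    Prop :=
  forall i j,
    holomorphic_map (atlas X) (space_atlas 'M[C]_M) (U i `&` U j) (g i j) /\
    forall z, (U i `&` U j) z ->
      g i j z \in unitmx /\
      forall v, phi i (triv_inv (phi j) (z, v)) = (z, g i j z *m v).

Definition transition_system (I : Type) (E : vectorBundle) (U : I -> set X)
    (g : I -> I -> X -> 'M[C]_M) : Prop :=
  exists phi : forall i, trivialization E (U i), transition_functions phi g.

End VectorBundles.

Section DifferentialForms.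
Variables (C : numClosedFieldType) (n : nat) (X : complexManifold C n).

(* A k-form is given by its expression in every chart: [w c x] is the          *)
(* alternating k-linear form at x on the tangent space, identified with C^n    *)
(* by the chart c. Only the c in the atlas and the x in their domain matter.   *)
Definition kform (k : nat) : Type :=
  chart X 'rV[C]_n -> X -> ('I_k -> 'rV[C]_n) -> C.

Definition update (k : nat) (v : 'I_k -> 'rV[C]_n) (a : 'I_k) (y : 'rV[C]_n) :
    'I_k -> 'rV[C]_n :=
  fun b => if b == a then y else v b.

Definition multilinear (k : nat) (f : ('I_k -> 'rV[C]_n) -> C) : Prop :=
  forall v a (r : C) y z,
    f (update v a (r *: y + z)) = r * f (update v a y) + f (update v a z).

Definition alternating (k : nat) (f : ('I_k -> 'rV[C]_n) -> C) : Prop :=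
  forall v a b, a != b -> v a = v b -> f v = 0.

(* w represents a section of Omega^k over the open set U.                      *)
Definition holomorphic_form (k : nat) (U : set X) (w : kform k) : Prop :=
  [/\ forall c x, atlas X c -> (chart_dom c `&` U) x ->
        multilinear (w c x) /\ alternating (w c x),
      forall c c' x v, atlas X c -> atlas X c' ->
        (chart_dom c `&` chart_dom c' `&` U) x ->
        w c x v = w c' x (fun a => 'd (c' \o chart_inv c) (c x) (v a))
    & forall c v, atlas X c ->
        holomorphic_on (c @` (chart_dom c `&` U))
          (fun y => w c (chart_inv c y) v : C)].

(* w and w' represent the same section over U. *)
Definition form_eq (k : nat) (U : set X) (w w' : kform k) : Prop :=
  forall c x v, atlas X c -> (chart_dom c `&` U) x -> w c x v = w' c x v.

Definition kform0 (k : nat) : kform k := fun _ _ _ => 0.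

Definition kform_sub (k : nat) (w w' : kform k) : kform k :=
  fun c x v => w c x v - w' c x v.

Definition dform (f : X -> C) : kform 1 :=
  fun c x v => 'd (f \o chart_inv c : 'rV[C]_n -> C) (c x) (v ord0).

(* Normalised so that a_1 /\ ... /\ a_k (v_1, ..., v_k) = det (a_i (v_j)) for   *)
(* 1-forms a_i.                                                                *)
Definition wedge (p q : nat) (w : kform p) (w' : kform q) : kform (p + q) :=
  fun c x v =>
    (p`! * q`!)%:R^-1 *
    \sum_(s : 'S_(p + q)) (-1) ^+ s *
       w c x (fun a => v (s (lshift q a))) *
       w' c x (fun b => v (s (rshift p b))).

Variable M : nat.

Definition dmx (g : X -> 'M[C]_M) : 'M[kform 1]_M :=
  \matrix_(a, b) dform (fun x => g x a b).

Definition mx_mulform (k : nat) (h : X -> 'M[C]_M) (A : 'M[kform k]_M) :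
    'M[kform k]_M :=
  \matrix_(a, b) (fun c x v => \sum_(l < M) h x a l * A l b c x v).

Definition mxwedge (p q : nat) (A : 'M[kform p]_M) (B : 'M[kform q]_M) :
    'M[kform (p + q)]_M :=
  \matrix_(a, b) (fun c x v => \sum_(l < M) wedge (A a l) (B l b) c x v).

Definition form_trace (k : nat) (A : 'M[kform k]_M) : kform k :=
  fun c x v => \sum_(a < M) A a a c x v.

(* The product A_0 A_1 ... A_{k-1} (the identity matrix of 0-forms if k = 0).  *)
Fixpoint mxwedge_prod (k : nat) : ('I_k -> 'M[kform 1]_M) -> 'M[kform k]_M :=
  match k with
  | 0 => fun _ => \matrix_(a, b) (fun _ _ _ => (a == b)%:R)
  | k'.+1 => fun A =>
      mxwedge (A ord0) (mxwedge_prod (fun a => A (lift ord0 a)))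
  end.

Variables (I : Type) (g : I -> I -> X -> 'M[C]_M).

Definition inv_dg (i j : I) : 'M[kform 1]_M :=
  mx_mulform (fun x => invmx (g i j x)) (dmx (g i j)).

(* The indices i_1, ..., i_{k+1} are i 0, ..., i k, with k = ord_max.          *)
Definition tform (k : nat) (i : 'I_k.+1 -> I) : kform k :=
  fun c x v =>
    \sum_(s : 'S_k.+1) (-1) ^+ s / (k.+1)`!%:R *
      form_trace
        (mxwedge_prod (fun a : 'I_k =>
           inv_dg (i (s (widen_ord (leqnSn k) a))) (i (s ord_max)))) c x v.

End DifferentialForms.

Arguments kform0 {C n} X k _ _ _.

Section Cech.
Variables (C : numClosedFieldType) (n : nat) (X : complexManifold C n).
Variables (disp : Order.disp_t) (I : orderType disp) (U : I -> set X).

Definition cover_meet (p : nat) (i : 'I_p -> I) : set X := \bigcap_a U (i a).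

Definition increasing (p : nat) (i : 'I_p -> I) : Prop :=
  forall a b : 'I_p, (a < b)%N -> (i a < i b)%O.

(* Representatives of the Cech p-cochains with coefficients in Omega^k: only   *)
(* the values at increasing i, restricted to [cover_meet i], matter.           *)
Definition cochain (k p : nat) : Type := ('I_p.+1 -> I) -> kform X k.

Definition is_cochain (k p : nat) (s : cochain k p) : Prop :=
  forall i, increasing i -> holomorphic_form (cover_meet i) (s i).

Definition cochain_eq (k p : nat) (s s' : cochain k p) : Prop :=
  forall i, increasing i -> form_eq (cover_meet i) (s i) (s' i).

Definition cech_diff (k p : nat) (s : cochain k p) : cochain k p.+1 :=
  fun i c x v =>
    \sum_(j < p.+2) (-1) ^+ j * s (fun a => i (lift j a)) c x v.

Definition is_cocycle (k p : nat) (s : cochain k p) : Prop :=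
  is_cochain s /\ cochain_eq (cech_diff s) (fun _ => kform0 X k).

Definition is_coboundary (k p : nat) : cochain k p -> Prop :=
  match p with
  | 0 => fun s => cochain_eq s (fun _ => kform0 X k)
  | p'.+1 => fun s =>
      exists2 b : cochain k p', is_cochain b & cochain_eq s (cech_diff b)
  end.

(* The class of a cocycle in the quotient of cocycles by coboundaries, as a    *)
(* coset.                                                                      *)
Definition cech_class (k p : nat) (s : cochain k p) : set (cochain k p) :=
  [set s' | is_cocycle s' /\ is_coboundary (fun i => kform_sub (s' i) (s i))].

(* The underlying set of the p-th Cech cohomology of Omega^k. *)
Definition cech_cohomology (k p : nat) : set (set (cochain k p)) :=
  [set cech_class s | s in @is_cocycle k p].

Definition fhat (M : nat) (k : nat) (g : I -> I -> X -> 'M[C]_M) :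
    cochain k k :=
  fun i => tform g i.

End Cech.

Arguments fhat {C n X disp I M} k g _ _ _ _.

(* Main.v *)
From HB Require Import structures.
Require Import Defs.
From mathcomp Require Import all_boot all_order all_fingroup all_algebra.
From mathcomp Require Import complex.
From mathcomp Require Import all_classical all_reals topology normedtype derive.
From mathcomp Require Import landau zify ring.

(** Fix an index m and put alpha_i = g_im^-1 dg_im. From g_ij g_jm = g_im one
    gets g_ij^-1 dg_ij = g_jm (alpha_i - alpha_j) g_jm^-1, so by invariance of
    the trace t is the antisymmetrization over the indices of
    tr ((alpha_1 - alpha_(k+1)) ... (alpha_k - alpha_(k+1))). The Cech
    differential of t is therefore an antisymmetrized sum over S_(k+2) of
    monomials each of which involves at most k of the k+2 indices;
    transposing two of the missing ones shows that it vanishes.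

    For two trivializations phi, phi', the family (phi_i, phi'_i) is a
    trivialization for the doubled cover indexed by I x {0,1}, whose transition
    functions contain g and g'. The cocycle identity for all (not only
    increasing) tuples of I x {0,1}, summed over the simplices of the prism
    over (i_1, ..., i_(k+1)), exhibits t' - t as a coboundary. *)

Set Implicit Arguments.
Unset Strict Implicit.
Unset Printing Implicit Defensive.

Import Order.TTheory GRing.Theory Num.Theory.
Import numFieldNormedType.Exports.

Local Open Scope classical_set_scope.
Local Open Scope ring_scope.

(** * Antisymmetrized traces *)

(** Precomposing [s] with the transposition of [a] and [b] keeps every value [s (h x)] and flips the
    sign, so the sum equals its own opposite. *)
Lemma sum_perm_missing_two (R : numDomainType) (m k : nat) (h : 'I_k -> 'I_m)
    (F : ('I_k -> 'I_m) -> R) (a b : 'I_m) :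
  a != b -> (forall x, h x != a) -> (forall x, h x != b) ->
  \sum_(s : 'S_m) (-1) ^+ s * F (fun x => s (h x)) = 0.
Proof.
move=> ab ha hb; set S := (LHS).
have : S = - S.
  rewrite {1}/S (reindex_inj (mulgI (tperm a b))) /= /S -sumrN.
  apply: eq_bigr => s _; rewrite odd_permM odd_tperm ab signr_addb mulN1r mulNr.
  congr (- (_ * F _)); apply/funext => x.
  by rewrite permM tpermD // eq_sym.
by move/eqP; rewrite -addr_eq0 -mulr2n mulrn_eq0 => /eqP.
Qed.

(* h misses at least two values. *)
Lemma sum_perm_missing_card (R : numDomainType) (k : nat)
    (h : 'I_k -> 'I_k.+2) (F : ('I_k -> 'I_k.+2) -> R) :
  \sum_(s : 'S_k.+2) (-1) ^+ s * F (fun x => s (h x)) = 0.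
Proof.
have cD : (1 < #|[predC codom h]|)%N.
  have := cardC [in codom h]; rewrite card_ord => cD.
  have := leq_image_card h predT; rewrite card_ord => ch.
  by rewrite -(leq_add2l #|[in codom h]|) cD addn2 !ltnS.
have [a [b [aD bD ab]]] := card_gt1P cD.
apply: (sum_perm_missing_two _ ab) => x; apply: contraTneq isT => hx.
- by move: aD; rewrite inE -hx codom_f.
- by move: bD; rewrite inE -hx codom_f.
Qed.

(** A permutation of [m.+1] points amounts to the image [j] of 0 and a permutation of the other [m]
    points; its sign is (-1)^j times that of the latter. This merges the Cech differential with the
    antisymmetrization. *)
Lemma sum_lift_perm (R : pzRingType) (m : nat) (H : ('I_m -> 'I_m.+1) -> R) :
  \sum_(j < m.+1) (-1) ^+ j * \sum_(s : 'S_m) (-1) ^+ s * H (fun a => lift j (s a))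
  = \sum_(s : 'S_m.+1) (-1) ^+ s * H (fun a => s (lift ord0 a)).
Proof.
rewrite [RHS](partition_big (fun s : 'S_m.+1 => s ord0) predT) //=.
apply: eq_bigr => j _; rewrite mulr_sumr.
(* The inverse of [lift_perm ord0 j]: delete 0 from the source and [s ord0] from the target. The
   default of [odflt] is never reached, [s] being injective. *)
pose ulsf (s : 'S_m.+1) a := odflt a (unlift (s ord0) (s (lift ord0 a))).
have ulsfK (s : 'S_m.+1) a : lift (s ord0) (ulsf s a) = s (lift ord0 a).
  rewrite /ulsf; case: unliftP => [l -> //|] /perm_inj /eqP.
  by rewrite eq_sym (negbTE (neq_lift _ _)).
have inj_ulsf (s : 'S_m.+1) : injective (ulsf s).
  by move=> a b E; apply/(@lift_inj _ ord0)/(@perm_inj _ s); rewrite -!ulsfK E.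
rewrite [RHS](reindex (lift_perm ord0 j)) /=.
  apply: eq_big => [s|s _]; first by rewrite lift_perm_id eqxx.
  rewrite mulrA odd_lift_perm /= signr_addb signr_odd.
  by congr (_ * H _); apply/funext => a; rewrite lift_perm_lift.
exists (fun s => perm (@inj_ulsf s)) => [s _|s].
  apply/permP => a; rewrite permE; apply: (@lift_inj _ j).
  by rewrite -[X in lift X (ulsf _ _)](lift_perm_id ord0 j s) ulsfK lift_perm_lift.
rewrite inE => /eqP sj; apply/permP => a.
case: (unliftP ord0 a) => [l ->|->]; last by rewrite lift_perm_id sj.
by rewrite lift_perm_lift permE -sj ulsfK.
Qed.

(** * Alternating products of matrices and their traces *)

Section MatrixProducts.
Variables (C : numFieldType) (M : nat).
Implicit Types A B : 'M[C]_M.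

Lemma prod_conjmx (k : nat) (B : 'M[C]_M) (X : 'I_k -> 'M[C]_M) :
  B \in unitmx ->
  \prod_(a < k) (B *m X a *m invmx B) = B *m (\prod_(a < k) X a) *m invmx B.
Proof.
move=> uB; elim: k X => [|k IH] X; first by rewrite !big_ord0 mulmx1 mulmxV.
rewrite !big_ord_recl IH -!mulmxE !mulmxA -[_ *m invmx B *m B]mulmxA.
by rewrite mulVmx // mulmx1.
Qed.

Lemma mxtrace_conj B A : B \in unitmx -> \tr (B *m A *m invmx B) = \tr A.
Proof. by move=> uB; rewrite mxtrace_mulC mulmxA mulVmx // mul1mx. Qed.

(** The value at the vectors [v] of a wedge product of matrices of 1-forms, [N a] being the [a]-th
    matrix as a function of one vector. *)
Definition alt_prod (T : Type) (k : nat) (N : 'I_k -> T -> 'M[C]_M) (v : 'I_k -> T) :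
    'M[C]_M :=
  \sum_(s : 'S_k) (-1) ^+ s *: \prod_(a < k) N a (v (s a)).

(** Pointwise model of [tform], with [N p q] standing for g_pq^-1 dg_pq at a point. *)
Definition alt_trace (J T : Type) (k : nat) (N : J -> J -> T -> 'M[C]_M)
    (i : 'I_k.+1 -> J) (v : 'I_k -> T) : C :=
  \sum_(s : 'S_k.+1) (-1) ^+ s / (k.+1)`!%:R *
    \tr (alt_prod (fun a => N (i (s (widen_ord (leqnSn k) a))) (i (s ord_max))) v).

(* In the expansion of the product of the differences, K t e is the monomial
   choosing the subtracted term exactly at the positions a with e a; phi e lists
   the indices it involves. *)
Lemma alt_trace_cocycle (J T : Type) (k : nat) (N : J -> J -> T -> 'M[C]_M)
    (A : J -> 'M[C]_M) (al : J -> T -> 'M[C]_M) (i : 'I_k.+2 -> J) (v : 'I_k -> T) :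
  (forall p, A (i p) \in unitmx) ->
  (forall p q y, N (i p) (i q) y =
     A (i q) *m (al (i p) y - al (i q) y) *m invmx (A (i q))) ->
  \sum_(j < k.+2) (-1) ^+ j * alt_trace N (fun a => i (lift j a)) v = 0.
Proof.
move=> uA NE.
pose beta (p : 'I_k.+2) := al (i p).
pose phi (e : {ffun 'I_k -> bool}) a : 'I_k.+2 :=
  lift ord0 (if e a then ord_max else widen_ord (leqnSn k) a).
pose K (t : 'S_k) (e : {ffun 'I_k -> bool}) (h : 'I_k -> 'I_k.+2) : C :=
  (-1) ^+ t * \tr (\prod_(a < k) ((-1) ^+ e a *: beta (h a) (v (t a)))).
pose H (f : 'I_k.+1 -> 'I_k.+2) : C := ((k.+1)`!%:R)^-1 *
  \tr (alt_prod (fun a => N (i (f (widen_ord (leqnSn k) a))) (i (f ord_max))) v).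
have HE (s : 'S_k.+2) : H (fun a => s (lift ord0 a)) =
    ((k.+1)`!%:R)^-1 * \sum_t \sum_e K t e (fun a => s (phi e a)).
  rewrite /H; congr (_ * _); rewrite /alt_prod raddf_sum /=; apply: eq_bigr => t _.
  rewrite /K -mulr_sumr mxtraceZ; congr (_ * _).
  under eq_bigr do rewrite NE.
  (* All factors are conjugated by the same matrix, that of the last index, so the trace removes
     it. *)
  rewrite prod_conjmx // mxtrace_conj // -raddf_sum /=; congr (\tr _).
  rewrite -(bigA_distr_bigA (fun a (e : bool) =>
    (-1) ^+ e *: beta (s (lift ord0 (if e then ord_max else widen_ord (leqnSn k) a)))
                 (v (t a)))).
  by apply: eq_bigr => a _; rewrite big_bool /= expr1 expr0 scaleN1r scale1r addrC.
transitivity (\sum_(s : 'S_k.+2) (-1) ^+ s * H (fun a => s (lift ord0 a))).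
  rewrite -sum_lift_perm; apply: eq_bigr => j _; congr (_ * _).
  by apply: eq_bigr => s _; rewrite /H mulrA.
under eq_bigr => s _ do rewrite HE mulrCA.
rewrite -mulr_sumr; under eq_bigr do rewrite mulr_sumr.
rewrite exchange_big big1 ?mulr0 //= => t _.
under eq_bigr do rewrite mulr_sumr.
rewrite exchange_big big1 //= => e _.
exact: sum_perm_missing_card.
Qed.

(** Phrased with families that agree off [a0], so that it still applies after the arguments are
    permuted, at the permuted position. *)
Lemma prod_linear_factor (k : nat) (a0 : 'I_k) (r : C) (F Y Z : 'I_k -> 'M[C]_M) :
  F a0 = r *: Y a0 + Z a0 ->
  (forall a, a != a0 -> F a = Y a) -> (forall a, a != a0 -> F a = Z a) ->
  \prod_(a < k) F a = r *: \prod_(a < k) Y a + \prod_(a < k) Z a.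
Proof.
elim: k a0 F Y Z => [[]//|k IH] a0 F Y Z F0 FY FZ; rewrite !big_ord_recl.
case: (unliftP ord0 a0) F0 FY FZ => [l ->|->] F0 FY FZ.
  rewrite (IH l (fun a => F (lift ord0 a)) (fun a => Y (lift ord0 a))
             (fun a => Z (lift ord0 a))) //.
  - by rewrite mulrDr -!mulmxE -scalemxAr -(FY ord0) ?neq_lift // -(FZ ord0) ?neq_lift.
  - by move=> a al; rewrite FY // (inj_eq (@lift_inj _ _)).
  - by move=> a al; rewrite FZ // (inj_eq (@lift_inj _ _)).
rewrite F0 mulrDl -!mulmxE -scalemxAl; rewrite (eq_bigr (fun a => Y (lift ord0 a))) => [|a _]; last first.
  by rewrite FY // eq_sym neq_lift.
congr (_ + _ *m _); apply: eq_bigr => a _.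
by rewrite -FY ?FZ // eq_sym neq_lift.
Qed.

(** In the inner sums, composing with the transposition of [a] and [b] keeps each product, as
    [v a = v b], and flips its sign. *)
Lemma alt_trace_alternating (J T : Type) (k : nat) (N : J -> J -> T -> 'M[C]_M)
    (i : 'I_k.+1 -> J) (v : 'I_k -> T) (a b : 'I_k) :
  a != b -> v a = v b -> alt_trace N i v = 0.
Proof.
move=> ab vab; rewrite /alt_trace big1 // => s _.
set L := alt_prod _ _; suff -> : L = 0 by rewrite raddf0 mulr0.
have : L = - L.
  rewrite {1}/L /alt_prod (reindex_inj (mulIg (tperm a b))) /= /L -sumrN.
  apply: eq_bigr => t _; rewrite odd_permM odd_tperm ab signr_addb mulrN1 scaleNr.
  congr (- (_ *: _)); apply: eq_bigr => l _; rewrite permM.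
  by case: tpermP => // ->; rewrite vab.
move/eqP; rewrite -addr_eq0 -mulr2n -scaler_nat scaler_eq0 pnatr_eq0 /=.
by move/eqP.
Qed.

Lemma alt_trace_linear (J : Type) (V : lmodType C) (k : nat)
    (N : J -> J -> V -> 'M[C]_M) (i : 'I_k.+1 -> J) (v w u : 'I_k -> V)
    (a0 : 'I_k) (r : C) :
  (forall p q (s : C) (y z : V), N p q (s *: y + z) = s *: N p q y + N p q z) ->
  v a0 = r *: w a0 + u a0 ->
  (forall a, a != a0 -> v a = w a) -> (forall a, a != a0 -> v a = u a) ->
  alt_trace N i v = r * alt_trace N i w + alt_trace N i u.
Proof.
move=> linN v0 vw vu; rewrite /alt_trace mulr_sumr -big_split /=.
apply: eq_bigr => s _; rewrite mulrCA -mulrDr; congr (_ * _).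
rewrite -mxtraceZ -mxtraceD; congr (\tr _); rewrite /alt_prod.
rewrite scaler_sumr -big_split /=; apply: eq_bigr => t _.
rewrite scalerA [r * _]mulrC -scalerA -scalerDr; congr (_ *: _).
(* In the summand of [t], the argument [v a0] occurs only in the factor at position [t^-1 a0]. *)
have ne (a : 'I_k) : a != (t^-1)%g a0 -> t a != a0.
  by apply: contraNneq => <-; rewrite permK.
apply: (prod_linear_factor (a0 := (t^-1)%g a0)).
- by rewrite !permKV v0 linN.
- by move=> a /ne/vw ->.
- by move=> a /ne/vu ->.
Qed.

End MatrixProducts.

(** * Wedge products of matrices of 1-forms *)

Section WedgeProducts.
Variables (C : numClosedFieldType) (n : nat) (X : complexManifold C n) (M : nat).

Definition form_value (A : 'M[kform X 1]_M) (c : chart X 'rV[C]_n) (x : X)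
    (y : 'rV[C]_n) : 'M[C]_M :=
  \matrix_(a, b) A a b c x (fun _ => y).

Lemma form_valueE (A : 'M[kform X 1]_M) c x v a b :
  A a b c x v = form_value A c x (v ord0) a b.
Proof.
by rewrite mxE; congr (A a b c x); apply/funext => l; rewrite ord1.
Qed.

(** By induction: wedging a 1-form with a k-form sums over [s] in S_(k+1), and expanding the k-form
    adds a sum over [t] in S_k. Terms depend only on the product of [s] with [t] extended to fix 0,
    so every [t] contributes the same full sum, and the k! copies cancel the normalising factor. *)
Lemma mxwedge_prodE (k : nat) (A : 'I_k -> 'M[kform X 1]_M) c x v a b :
  mxwedge_prod A a b c x v = alt_prod (fun l => form_value (A l) c x) v a b.
Proof.
elim: k A v a b => [|k IH] A v a b.
  rewrite /= mxE /alt_prod summxE (bigD1 1%g) //= big_ord0 odd_perm1 scale1r mxE.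
  rewrite big1 ?addr0 // => s.
  by rewrite (_ : s = 1%g) ?eqxx //; apply/permP => - [].
rewrite /= mxE /wedge /alt_prod summxE.
under eq_bigr => l _ do rewrite mulr_sumr.
rewrite exchange_big /=.
pose H (s : 'S_k.+1) : C :=
  ((-1) ^+ s *: \prod_(l < k.+1) form_value (A l) c x (v (s l))) a b.
pose t0 (t : 'S_k) : 'S_k.+1 := lift_perm ord0 ord0 t.
transitivity (\sum_(s : 'S_k.+1) \sum_(t : 'S_k) (k`!)%:R^-1 * H (t0 t * s)%g).
  apply: eq_bigr => s _; rewrite (_ : 1`! * k`! = k`!)%N ?mul1n // -!mulr_sumr; congr (_ * _).
  under eq_bigr => l _ do rewrite IH form_valueE /alt_prod summxE mulr_sumr.
  rewrite exchange_big; apply: eq_bigr => t _ /=.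
  rewrite /H big_ord_recl mxE -mulmxE mxE mulr_sumr; apply: eq_bigr => l _.
  rewrite odd_permM odd_lift_perm /= signr_addb permM lift_perm_id.
  rewrite (_ : lshift k ord0 = ord0); last exact: val_inj.
  rewrite [X in _ * X]mxE -!mulrA [in RHS]mulrCA; congr (_ * _).
  rewrite [in LHS]mulrCA; congr (_ * (_ * _)).
  congr (fun_of_matrix _ l b).
  apply: eq_bigr => i _; rewrite permM lift_perm_lift.
  by congr (form_value _ _ _ (v (s _))); apply: val_inj.
rewrite exchange_big /=.
transitivity (\sum_(t : 'S_k) (k`!)%:R^-1 * \sum_(s : 'S_k.+1) H s).
  apply: eq_bigr => t _; rewrite -mulr_sumr [in RHS](reindex_inj (mulgI (t0 t))) //.
rewrite sumr_const. rewrite card_Sn -[LHS]mulr_natl mulrA mulfV ?mul1r //.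
by rewrite pnatr_eq0 -lt0n fact_gt0.
Qed.
End WedgeProducts.

(** * The prism operator *)

(** [F j l] stands for the signed l-th face of the j-th simplex of a prism, [G j l] for the signed
    j-th simplex of the prism over the l-th face, [Q j] for the walls between consecutive simplices.
    The walls telescope to the two ends; the other faces regroup into prisms over faces. *)
Lemma sum_prism (R : zmodType) (k : nat) (F G : nat -> nat -> R) (Q : nat -> R) :
  (forall j l, (l < j)%N -> F j l = - G j.-1 l) ->
  (forall j l, (j < l)%N -> F j l.+1 = - G j l) ->
  (forall j, F j j = Q j) -> (forall j, F j j.+1 = - Q j.+1) ->
  \sum_(0 <= j < k.+1) \sum_(0 <= l < k.+2) F j l =
  Q 0%N - Q k.+1 - \sum_(0 <= j < k) \sum_(0 <= l < k.+1) G j l.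
Proof.
move=> Flt Fgt Fd Fd1.
(* Row [j] is split around its two walls, at [l = j] and [l = j.+1]. *)
have rowE j : (j < k.+1)%N -> \sum_(0 <= l < k.+2) F j l =
    - (Q j.+1 - Q j) - (\sum_(0 <= l < j) G j.-1 l + \sum_(j.+1 <= l < k.+1) G j l).
  move=> jk; rewrite (big_cat_nat (n := j)) //=; last exact: ltnW (ltnW _).
  rewrite [in X in _ + X]big_ltn; last exact: ltnW.
  rewrite [in X in _ + (_ + X)]big_ltn // Fd Fd1 big_add1 /=.
  under eq_big_nat => l /andP[_ lj] do rewrite Flt //.
  under [X in _ + (_ + (_ + X))]eq_big_nat => l /andP[lj _] do rewrite Fgt //.
  rewrite !sumrN !opprD !opprK addrCA [- _ + (- Q _ + _)]addrCA.
  by rewrite !addrA [Q j - _]addrC.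
under eq_big_nat => j /andP[_ jk] do rewrite rowE //.
rewrite sumrB sumrN telescope_sumr // opprB; congr (_ - _).
(* Row [j] of [G] gets its entries [l <= j] from row [j.+1] of [F], and its entries [l > j] from row
   [j]. *)
rewrite big_split /= big_ltn // big_geq // add0r big_add1 /=.
rewrite [X in _ + X]big_nat_recr //= [X in _ + (_ + X)]big_geq // addr0 -big_split /=.
apply: eq_big_nat => j /andP[_ jk].
by rewrite -big_cat_nat //=; exact: ltnW.
Qed.

Lemma prism_idx_subproof (k : nat) (j : 'I_k) (a : 'I_k.+1) : (a - (j < a) < k)%N.
Proof. by have := ltn_ord a; have := ltn_ord j; lia. Qed.

(** The degeneracy map repeating [j]: positions [j] and [j.+1] both go to [j]. *)
Definition prism_idx (k : nat) (j : 'I_k) (a : 'I_k.+1) : 'I_k :=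
  Ordinal (prism_idx_subproof j a).

(* The j-th simplex of the prism over i: (i_0,0), ..., (i_j,0), (i_j,1), ..., (i_(k-1),1). *)
Definition prism (I : Type) (k : nat) (j : 'I_k) (i : 'I_k -> I) (a : 'I_k.+1) :
    I * bool :=
  (i (prism_idx j a), (j < a)%N).

(** The cocycle identity is applied to each of the [k.+1] simplices of the prism over [i] and summed
    with signs. It is assumed for all tuples over [i], since a prism simplex repeats an index. *)
Lemma prism_homotopy (R : pzRingType) (I : Type) (k : nat)
    (T : ('I_k.+1 -> I * bool) -> R) (i : 'I_k.+1 -> I) :
  (forall e : 'I_k.+2 -> I * bool, (forall a, exists p, (e a).1 = i p) ->
     \sum_(j < k.+2) (-1) ^+ j * T (fun a => e (lift j a)) = 0) ->
  T (fun a => (i a, true)) - T (fun a => (i a, false)) =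
  \sum_(l < k.+1) (-1) ^+ l *
     \sum_(j < k) (-1) ^+ j * T (prism j (fun b => i (lift l b))).
Proof.
move=> T0.
(* Tuples are extended to sequences on [nat]: faces are then given by [bump], and index identities
   become arithmetic. *)
pose T' (f : nat -> I * bool) := T (fun a => f a).
pose i' n := i (inord n).
pose P j (f : nat -> I) a : I * bool := (f (a - (j < a))%N, (j < a)%N).
pose F j l := (-1) ^+ (j + l) * T' (fun a => P j i' (bump l a)).
pose G j l := (-1) ^+ (j + l) * T' (P j (fun n => i' (bump l n))).
pose Q j := T' (fun a => (i' a, (j <= a)%N)).
have sN m (x : R) : - ((-1) ^+ m * x) = (-1) ^+ m.+1 * x.
  by rewrite exprS -mulrA mulN1r.
have := @sum_prism _ k F G Q.
have -> : \sum_(0 <= j < k.+1) \sum_(0 <= l < k.+2) F j l = 0.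
  rewrite big_mkord big1 // => j _; rewrite big_mkord.
  have /T0 : forall a : 'I_k.+2, exists p, (P j i' a).1 = i p by move=> a; eexists.
  move/(congr1 ( *%R ((-1) ^+ j))); rewrite mulr0 mulr_sumr => E; rewrite -[RHS]E.
  by apply: eq_bigr => l _; rewrite mulrA -exprD.
have -> : Q 0%N = T (fun a => (i a, true)).
  by congr T; apply/funext => a; rewrite /i' inord_val.
have -> : Q k.+1 = T (fun a => (i a, false)).
  by congr T; apply/funext => a; rewrite /i' inord_val leqNgt ltn_ord.
have -> : \sum_(0 <= j < k) \sum_(0 <= l < k.+1) G j l = \sum_(l < k.+1) (-1) ^+ l *
     \sum_(j < k) (-1) ^+ j * T (prism j (fun b => i (lift l b))).
  rewrite exchange_big_nat /= big_mkord; apply: eq_bigr => l _.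
  rewrite big_mkord mulr_sumr; apply: eq_bigr => j _.
  rewrite mulrA -exprD addnC; congr (_ * T _); apply/funext => a.
  rewrite /P /prism /i'; congr (i _, _); apply: val_inj => /=.
  by rewrite inordK // /bump; have /= := ltn_ord (prism_idx j a); lia.
move=> H; apply/esym/eqP; rewrite -subr_eq0 -opprB oppr_eq0; apply/eqP/esym/H => {H}.
- move=> j l lj; rewrite /F /G sN -addSn prednK ?(leq_ltn_trans _ lj) //.
  congr (_ * T _); apply/funext => a; rewrite /P /bump.
  by congr (i' _, _); lia.
- move=> j l jl; rewrite /F /G sN -addnS.
  congr (_ * T _); apply/funext => a; rewrite /P /bump.
  by congr (i' _, _); lia.
(* Dropping (i_j,0) from the j-th simplex leaves label 1 from position [j] on; dropping (i_j,1), in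
   the next case, leaves it from [j.+1] on. *)
- move=> j; rewrite /F /Q addnn -signr_odd odd_double mul1r.
  congr (T _); apply/funext => a; rewrite /P /bump.
  by congr (i' _, _); lia.
- move=> j; rewrite /F /Q addnS addnn -signr_odd /= odd_double mulN1r.
  congr (- T _); apply/funext => a; rewrite /P /bump.
  by congr (i' _, _); lia.
Qed.

(** * Iterated complex differentiability *)

Section NearEq.
Variables (K : numFieldType) (V W : normedModType K).

(** The zero map satisfies the first-order expansion, and differentials are unique. Applied to a
    difference, this shows that the differential depends only on the germ at [x]. *)
Lemma near_eq0_diff (e : V -> W) (x : V) :
  (\near x, e x = 0) -> differentiable e x /\ ('d e x : V -> W) = 0.
Proof.
move=> e0; have ex0 : e x = 0 := nbhs_singleton e0.
have E : e \o shift x = cst (e x) + (\0 : V -> W) +o_ 0 id.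
  rewrite ex0; apply: eqaddoE. rewrite [X in _ = X + _](_ : _ = 0) ?add0r; last first.
    by [].
  have e0' : \forall y \near (0 : V), e (y + x) = 0.
    by move: e0; rewrite (near_shift 0); apply: filterS => y /=; rewrite subr0.
  apply/eqoP => eps eps0; apply: filterS e0' => y /= ->.
  by rewrite normr0 mulr_ge0 // ltW.
have c0 : continuous (\0 : V -> W) by move=> ?; exact: cvg_cst.
have D := diff_unique c0 E.
by split=> //; apply/diff_locallyP; rewrite D.
Qed.

Lemma near_eq_differentiable (f g : V -> W) (x : V) :
  (\near x, f x = g x) -> differentiable f x -> differentiable g x.
Proof.
move=> fg df; have [|de _] := @near_eq0_diff (g - f) x.
  by apply: filterS fg => y fgy; change (g y - f y = 0); rewrite fgy subrr.
by rewrite -[g](subrK f); apply: differentiableD.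
Qed.

Lemma near_eq_diff (f g : V -> W) (x : V) :
  (\near x, f x = g x) -> differentiable f x -> 'd f x = 'd g x :> (V -> W).
Proof.
move=> fg df; have [|de e0] := @near_eq0_diff (g - f) x.
  by apply: filterS fg => y fgy; change (g y - f y = 0); rewrite fgy subrr.
by rewrite -[g](subrK f) diffD // e0; apply/funext => y /=; rewrite add0r.
Qed.

Lemma diff_sum (J : Type) (r : seq J) (F : J -> V -> W) (x : V) :
  (forall j, differentiable (F j) x) ->
  differentiable (\sum_(j <- r) F j) x /\
  forall y, 'd (\sum_(j <- r) F j) x y = \sum_(j <- r) 'd (F j) x y.
Proof.
move=> dF; elim: r => [|j r [dr IH]].
  rewrite big_nil; split; first exact: (differentiable_cst (0 : W)).
  by move=> y; rewrite big_nil (diff_cst (0 : W)).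
rewrite big_cons; split; first exact: differentiableD.
by move=> y; rewrite big_cons diffD //= IH.
Qed.

Lemma open_near (D : set V) (f g : V -> W) :
  open D -> (forall x, D x -> f x = g x) -> forall x, D x -> \near x, f x = g x.
Proof.
by move=> oD fg x Dx; apply: filterS (open_nbhs_nbhs (conj oD Dx)) => y /fg.
Qed.

End NearEq.

Section CDifferentiable.
Variable C : numClosedFieldType.
Implicit Types V W : normedModType C.

Lemma near_eq_continuous (T T' : topologicalType) (f g : T -> T') x :
  (\near x, f x = g x) -> {for x, continuous f} -> {for x, continuous g}.
Proof.
move=> fg cf; rewrite /prop_for /continuous_at -(nbhs_singleton fg).
exact: cvg_trans (near_eq_cvg fg) cf.
Qed.

Lemma cdifferentiable_ext V W m (D : set V) (f g : V -> W) :
  open D -> (forall x, D x -> f x = g x) ->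
  cdifferentiable m D f -> cdifferentiable m D g.
Proof.
move=> oD; elim: m f g => [|m IH] f g fg /=.
  by move=> cf x Dx; apply: near_eq_continuous (open_near oD fg Dx) (cf x Dx).
move=> [df cf]; split=> [x Dx|v].
  by apply: near_eq_differentiable (open_near oD fg Dx) (df x Dx).
apply: IH (cf v) => x Dx.
by rewrite (near_eq_diff (open_near oD fg Dx) (df x Dx)).
Qed.

Lemma cdifferentiable_sub V W m (D D' : set V) (f : V -> W) :
  D' `<=` D -> cdifferentiable m D f -> cdifferentiable m D' f.
Proof.
move=> DD'; elim: m f => [|m IH] f /=; first by move=> cf x /DD'; exact: cf.
by move=> [df cf]; split=> [x /DD'/df //|v]; apply: IH.
Qed.

(** At every order the condition bears on the total function at single points, so [D'] need only
    contain [x]. This permits a choice of chart around each point. *)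
Lemma cdifferentiable_local V W m (D : set V) (f : V -> W) :
  (forall x, D x -> exists2 D', D' x & cdifferentiable m D' f) ->
  cdifferentiable m D f.
Proof.
elim: m f => [|m IH] f H /=.
  by move=> x /H[D' D'x cf]; exact: cf.
split=> [x /H[D' D'x [df _]]|v]; first exact: df.
by apply: IH => x /H[D' D'x [_ cf]]; exists D' => //; exact: cf.
Qed.

(** Differentials of products and compositions keep undifferentiated factors, which the inductions
    below use at one order less. *)
Lemma cdifferentiableS V W m (D : set V) (f : V -> W) :
  cdifferentiable m.+1 D f -> cdifferentiable m D f.
Proof.
elim: m f => [|m IH] f [df cf] /=.
  by move=> x /df; exact: differentiable_continuous.
by split=> [|v]; [exact: df|exact: IH (cf v)].
Qed.

Lemma cdifferentiable_cst V W m (D : set V) (w : W) :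
  cdifferentiable m D (fun _ => w).
Proof.
elim: m w => [|m IH] w /=; first by move=> x _; exact: cvg_cst.
split=> [x _|v]; first exact: differentiable_cst.
rewrite (_ : (fun x => _) = fun _ => 0); first exact: IH.
by apply/funext => x; rewrite (_ : (fun _ => w) = cst w) // diff_cst.
Qed.

Lemma cdifferentiable_lin V W (W' : normedModType C) m (D : set V)
    (f : V -> W) (L : {linear W -> W'}) :
  open D -> continuous L -> cdifferentiable m D f -> cdifferentiable m D (L \o f).
Proof.
move=> oD cL; elim: m f => [|m IH] f /=.
  by move=> cf x Dx; apply: continuous_comp; [exact: cf|exact: cL].
move=> [df cf]; split=> [x Dx|v].
  by apply: differentiable_comp; [exact: df|exact: linear_differentiable].
apply: cdifferentiable_ext oD _ (IH _ (cf v)) => x Dx.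
by rewrite diff_comp ?diff_lin //; [exact: df|exact: linear_differentiable].
Qed.

Lemma cdifferentiableD V W m (D : set V) (f g : V -> W) :
  open D -> cdifferentiable m D f -> cdifferentiable m D g ->
  cdifferentiable m D (fun x => f x + g x).
Proof.
move=> oD; elim: m f g => [|m IH] f g /=.
  by move=> cf cg x Dx; apply: continuousD; [exact: cf|exact: cg].
move=> [df cf] [dg cg]; split=> [x Dx|v].
  by apply: differentiableD; [exact: df|exact: dg].
apply: cdifferentiable_ext oD _ (IH _ _ (cf v) (cg v)) => x Dx.
by rewrite (_ : (fun _ => _) = f + g) // diffD; [|exact: df|exact: dg].
Qed.

Lemma cdifferentiable_sum V W m (D : set V) (J : Type) (r : seq J) (P : pred J)
    (f : J -> V -> W) :
  open D -> (forall j, cdifferentiable m D (f j)) ->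
  cdifferentiable m D (fun x => \sum_(j <- r | P j) f j x).
Proof.
move=> oD cf; elim: r => [|j r IH].
  by under eq_fun do rewrite big_nil; exact: cdifferentiable_cst.
under eq_fun do rewrite big_cons.
by case: (P j) => //; apply: cdifferentiableD.
Qed.

Lemma cdifferentiableM V m (D : set V) (f g : V -> C) :
  open D -> cdifferentiable m D f -> cdifferentiable m D g ->
  cdifferentiable m D (fun x => f x * g x).
Proof.
move=> oD; elim: m f g => [|m IH] f g /=.
  by move=> cf cg x Dx; apply: continuousM; [exact: cf|exact: cg].
move=> cf cg; have [df cdf] := cf; have [dg cdg] := cg; split=> [x Dx|v].
  by apply: differentiableM; [exact: df|exact: dg].
apply: cdifferentiable_ext oD _
  (cdifferentiableD oD (IH _ _ (cdifferentiableS cf) (cdg v))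
     (IH _ _ (cdifferentiableS cg) (cdf v))) => x Dx.
by rewrite (_ : (fun _ => _) = f * g) // diffM; [|exact: df|exact: dg].
Qed.

Lemma mx_entry_linear (p q : nat) (a : 'I_p) (b : 'I_q) :
  exists2 L : {linear 'M[C]_(p, q) -> C}, continuous L & forall A, L A = A a b.
Proof.
have lin : linear (fun A : 'M[C]_(p, q) => A a b : C^o).
  by move=> u A B; rewrite !mxE.
pose linM := GRing.isLinear.Build _ _ _ _ _ lin.
pose L : {linear 'M[C]_(p, q) -> C} := HB.pack (fun A : 'M[C]_(p, q) => A a b) linM.
by exists L => //; exact: coord_continuous.
Qed.

Lemma cdifferentiable_entry V (p q m : nat) (D : set V) (f : V -> 'M[C]_(p, q)) a b :
  open D -> cdifferentiable m D f -> cdifferentiable m D (fun x => f x a b : C).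
Proof.
move=> oD cf; have [L cL LE] := mx_entry_linear a b.
by apply: (cdifferentiable_ext oD _ (cdifferentiable_lin oD cL cf)) => x _; exact: LE.
Qed.

Lemma cdifferentiable_mx V (p q m : nat) (D : set V) (f : V -> 'M[C]_(p, q)) :
  open D -> (forall a b, cdifferentiable m D (fun x => f x a b : C)) ->
  cdifferentiable m D f.
Proof.
move=> oD cf.
have cdelta a b : cdifferentiable m D (fun x => f x a b *: (delta_mx a b : 'M[C]_(p, q))).
  have lin : linear ( *:%R^~ (delta_mx a b : 'M[C]_(p, q)) : C -> _).
    by move=> u y z; rewrite scalerDl scalerA.
  pose linM := GRing.isLinear.Build _ _ _ _ _ lin.
  pose L : {linear C -> 'M[C]_(p, q)} := HB.pack ( *:%R^~ (delta_mx a b)) linM.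
  exact: (@cdifferentiable_lin _ _ _ m D _ L oD (@scalel_continuous _ _ _) (cf a b)).
have := cdifferentiable_sum (index_enum 'I_p) predT oD
  (fun a => cdifferentiable_sum (index_enum 'I_q) predT oD (cdelta a)).
by apply: (cdifferentiable_ext oD) => x _; rewrite -matrix_sum_delta.
Qed.

(** The differential of [f \o h] evaluates that of [f] in a direction varying with [x]. Expanding
    this direction in the standard basis gives fixed directions, to which the induction applies;
    hence the row vectors in the middle. *)
Lemma cdifferentiable_comp V (N m : nat) (D : set V) (D' : set 'rV[C]_N)
    (f : 'rV[C]_N -> C) (h : V -> 'rV[C]_N) :
  open D -> (forall x, D x -> D' (h x)) ->
  cdifferentiable m D h -> cdifferentiable m D' f ->
  cdifferentiable m D (f \o h).
Proof.
move=> oD hD; elim: m f => [|m IH] f /=.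
  by move=> ch cf x Dx; apply: continuous_comp; [exact: ch|exact/cf/hD].
move=> ch [df cf]; have [dh cdh] := ch; split=> [x Dx|v].
  by apply: differentiable_comp; [exact: dh|exact/df/hD].
have := cdifferentiable_sum (m := m) (index_enum 'I_N) predT (D := D)
  (f := fun j x => 'd h x v 0 j * 'd f (h x) (delta_mx 0 j)) oD.
move=> H; apply: (cdifferentiable_ext oD _ (H _)) => [x Dx|j] {H}.
  rewrite [in RHS]diff_comp /=; [|exact: dh|exact/df/hD].
  rewrite [in RHS](row_sum_delta ('d h x v)) linear_sum.
  by apply: eq_bigr => j _; rewrite linearZ.
apply: (cdifferentiableM oD).
  exact: (cdifferentiable_entry _ _ oD (cdh v)).
exact: IH (cdifferentiableS ch) (cf (delta_mx 0 j)).
Qed.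

(** The map sending [y] to [(y, w)] has differential [(v, 0)] in the direction [v], so fixed
    directions stay fixed. *)
Lemma cdifferentiable_slice V W (V' : normedModType C) m (D : set V)
    (D' : set (V * V')) (f : V * V' -> W) (w : V') :
  open D -> (forall x, D x -> D' (x, w)) ->
  cdifferentiable m D' f -> cdifferentiable m D (fun x => f (x, w)).
Proof.
move=> oD hD.
have dp x : is_diff x (fun y : V => (y, w)) (fun y => (y, 0)).
  exact: is_diff_pair.
elim: m f => [|m IH] f /=.
  move=> cf x Dx; apply: (@continuous_comp _ _ _ (fun y => (y, w)) f).
    by apply: differentiable_continuous; exact: ex_diff.
  exact/cf/hD.
move=> [df cf]; split=> [x Dx|v].
  apply: (@differentiable_comp _ _ _ _ (fun y => (y, w)) f); last exact/df/hD.
  exact: ex_diff.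
apply: cdifferentiable_ext oD _ (IH _ (cf (v, 0))) => x Dx.
rewrite (@diff_comp _ _ _ _ (fun y => (y, w)) f) /=; last exact/df/hD.
  by rewrite diff_val.
exact: ex_diff.
Qed.

End CDifferentiable.

(** * Transition functions *)

Lemma finite_bigcap_open (T : topologicalType) (J : finType) (U : J -> set T) :
  (forall j, open (U j)) -> open (\bigcap_j U j).
Proof.
move=> oU; rewrite openE => z Dz.
have := filter_forall (nbhs_filter z) (fun j => open_nbhs_nbhs (conj (oU j) (Dz j I))).
by apply: filterS => w Dw j _; exact: Dw.
Qed.

Section ChartLemmas.
Variables (C : numClosedFieldType) (X : topologicalType) (V : normedModType C).

Lemma chart_img_open (c : chart X V) (D : set X) :
  is_chart c -> open D -> open (c @` (chart_dom c `&` D)).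
Proof.
move=> [_ oc cK _ ci] oD.
rewrite (_ : _ @` _ = chart_cod c `&` chart_inv c @^-1` D); last first.
  apply/seteqP; split=> [y [x [xc xD] <-]|y [[x xc <-]]] /=.
    by split; [exists x|rewrite /= cK].
  by rewrite /preimage /= cK // => xD; exists x.
rewrite openE => y [cy Dy]; rewrite /interior.
apply: filterI; first exact: open_nbhs_nbhs.
apply: (ci _ cy); exact: open_nbhs_nbhs.
Qed.

End ChartLemmas.

Section Transition.
Variables (C : numClosedFieldType) (n : nat) (X : complexManifold C n) (M : nat).
Variables (E : vectorBundle X M) (J : Type) (U : J -> set X).
Variables (phi : forall i, trivialization E (U i)) (g : J -> J -> X -> 'M[C]_M).
Hypothesis phig : transition_functions phi g.
Hypothesis oU : forall i, open (U i).

Lemma transition_unit i j z : U i z -> U j z -> g i j z \in unitmx.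
Proof. by move=> Ui Uj; have [_ /(_ z (conj Ui Uj))[]] := phig i j. Qed.

(** Over [z] the composite phi_i phi_l^-1 factors through phi_j; images of basis vectors are
    compared column by column. *)
Lemma transition_mul i j l z :
  U i z -> U j z -> U l z -> g i j z *m g j l z = g i l z.
Proof.
move=> Ui Uj Ul.
have tE a b v : U a z -> U b z -> phi a (triv_inv (phi b) (z, v)) = (z, g a b z *m v).
  by move=> Ua Ub; have [_ /(_ z (conj Ua Ub))[_]] := phig a b; exact.
apply/trmx_inj/row_matrixP => s; rewrite -!tr_col; congr (_^T).
rewrite !colE -mulmxA; set v := delta_mx s 0.
have -> : g i l z *m v = (phi i (triv_inv (phi l) (z, v))).2 by rewrite tE.
have [pl _] := triv_invK (phi l) v Ul.
rewrite -[triv_inv (phi l) _](triv_mapK (phi j)) ?tE //.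
by rewrite pl.
Qed.

Lemma transition_id i z : U i z -> g i i z = 1%:M.
Proof.
move=> Ui; have := transition_mul Ui Ui Ui.
move/(congr1 (mulmx (invmx (g i i z)))); rewrite mulmxA mulVmx ?mul1mx //.
exact: transition_unit.
Qed.

Lemma transition_inv i j z : U i z -> U j z -> invmx (g i j z) = g j i z.
Proof.
move=> Ui Uj; have := transition_mul Ui Uj Ui; rewrite transition_id //.
move/(congr1 (mulmx (invmx (g i j z)))); rewrite mulmxA mulVmx ?mul1mx ?mulmx1 //.
exact: transition_unit.
Qed.

Lemma transition_entry_holomorphic i j c (D : set X) a b :
  atlas X c -> open D -> D `<=` U i `&` U j ->
  holomorphic_on (c @` (chart_dom c `&` D))
    ((fun x => g i j x a b) \o chart_inv c : _ -> C).
Proof.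
move=> Ac oD DU m; have [hc _ _] := manifold_atlas X.
apply: (@cdifferentiable_entry _ _ _ _ _ _ (g i j \o chart_inv c)).
  exact: chart_img_open (hc _ Ac) oD.
have [[_ /(_ c (Chart setT id id) Ac erefl m) + ] _] := phig i j.
move=> H. apply: (cdifferentiable_sub _ H) => y [x [xc /DU xU] <-].
by exists x.
Qed.

Lemma transition_entry_differentiable i j c x a b :
  atlas X c -> chart_dom c x -> U i x -> U j x ->
  differentiable ((fun x => g i j x a b) \o chart_inv c : _ -> C) (c x).
Proof.
move=> Ac xc Ui Uj.
have [d _] := transition_entry_holomorphic (D := U i `&` U j) a b Ac
  (openI (oU i) (oU j)) (fun=> id) 1%N.
by apply: d; exists x.
Qed.

Definition diff_mx i j (c : chart X 'rV[C]_n) (x : X) (y : 'rV[C]_n) : 'M[C]_M :=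
  \matrix_(a, b) 'd ((fun x => g i j x a b) \o chart_inv c : _ -> C) (c x) y.

Lemma form_value_inv_dg i j c x y :
  form_value (inv_dg g i j) c x y = invmx (g i j x) *m diff_mx i j c x y.
Proof.
by apply/matrixP => a b; rewrite !mxE; apply: eq_bigr => l _; rewrite !mxE.
Qed.

Lemma tformE k (i : 'I_k.+1 -> J) c x v :
  tform g i c x v =
  alt_trace (fun p q y => invmx (g p q x) *m diff_mx p q c x y) i v.
Proof.
rewrite /tform /alt_trace; apply: eq_bigr => s _; congr (_ * _).
rewrite /form_trace /mxtrace; apply: eq_bigr => a _; rewrite mxwedge_prodE.
congr (fun_of_matrix _ a a); congr alt_prod; apply/funext => l.
by apply/funext => y; rewrite form_value_inv_dg.
Qed.

(** The Leibniz rule for g_il = g_ij g_jl. As that identity is known on the triple overlap only,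
    both sides are compared as functions agreeing near [c x]. *)
Lemma diff_mxM i j l c x y :
  atlas X c -> chart_dom c x -> U i x -> U j x -> U l x ->
  diff_mx i l c x y =
  diff_mx i j c x y *m g j l x + g i j x *m diff_mx j l c x y.
Proof.
move=> Ac xc Ui Uj Ul; have [hc _ _] := manifold_atlas X.
have [_ _ cK _ ci] := hc _ Ac.
apply/matrixP => a b; rewrite !mxE -big_split /=.
pose F (s : 'I_M) : 'rV[C]_n -> C :=
  ((fun x => g i j x a s) \o chart_inv c) * ((fun x => g j l x s b) \o chart_inv c).
have dF s : differentiable (F s) (c x).
  by apply: differentiableM; apply: transition_entry_differentiable.
have -> : 'd ((fun x => g i l x a b) \o chart_inv c : _ -> C) (c x) =
          'd (\sum_s F s) (c x) :> (_ -> _).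
  apply: near_eq_diff; last exact: transition_entry_differentiable.
  have oD : open (c @` (chart_dom c `&` (U i `&` U j `&` U l))).
    by apply: chart_img_open (hc _ Ac) _; do 2?apply: openI.
  have Dx : (c @` (chart_dom c `&` (U i `&` U j `&` U l))) (c x) by exists x.
  apply: filterS (open_nbhs_nbhs (conj oD Dx)) => _ [z [zc [[zi zj] zl]] <-].
  rewrite /= fct_sumE cK // -(transition_mul zi zj zl) mxE; apply: eq_bigr => s _.
  by rewrite /F /= /GRing.mul /= cK.
have [_ ->] := diff_sum (index_enum 'I_M) dF.
apply: eq_bigr => s _; rewrite /F diffM; [|exact: transition_entry_differentiable..].
rewrite /= cK // !mxE [RHS]addrC; congr (_ + _); exact: mulrC.
Qed.

(** Holds for any index type and for tuples with repetitions, as the prism argument on the doubled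
    cover requires. *)
Lemma tform_cocycle k (i : 'I_k.+2 -> J) c x v :
  atlas X c -> chart_dom c x -> (forall a, U (i a) x) ->
  \sum_(j < k.+2) (-1) ^+ j * tform g (fun a => i (lift j a)) c x v = 0.
Proof.
move=> Ac xc Ui; under eq_bigr do rewrite tformE.
pose m := i ord0; have Um : U m x by exact: Ui.
apply: (@alt_trace_cocycle _ _ _ _ _ _ (fun p => g p m x)
          (fun p y => invmx (g p m x) *m diff_mx p m c x y)) => [p|p q y].
  exact: transition_unit.
have [Up Uq] := (Ui p, Ui q); have uq := transition_unit Uq Um.
(* With dg_pm = dg_pq g_qm + g_pq dg_qm, the terms in dg_qm cancel against alpha_q. *)
rewrite (diff_mxM _ Ac xc Up Uq Um) !transition_inv // mulmxDr mulmxA.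
rewrite (transition_mul Uq Um Up) mulmxN [g (i q) m x *m (_ *m _)]mulmxA.
rewrite (transition_mul Uq Um Uq) transition_id // mul1mx mulmxDr.
rewrite [g (i q) (i p) x *m (g _ _ _ *m _)]mulmxA (transition_mul Uq Up Uq).
rewrite transition_id // mul1mx addrK -!mulmxA (transition_mul Uq Um Uq).
by rewrite transition_id // mulmx1.
Qed.

Lemma diff_mx_chart i j c c' x y :
  atlas X c -> atlas X c' -> chart_dom c x -> chart_dom c' x -> U i x -> U j x ->
  diff_mx i j c x y = diff_mx i j c' x ('d (c' \o chart_inv c) (c x) y).
Proof.
move=> Ac Ac' xc xc' Ui Uj; have [hc _ /(_ c c' Ac Ac') cc] := manifold_atlas X.
have [oc _ cK _ _] := hc _ Ac; have [oc' _ cK' _ _] := hc _ Ac'.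
have [dcc _] := cc 1%N.
have Dx : (c @` (chart_dom c `&` chart_dom c')) (c x) by exists x.
apply/matrixP => a b; rewrite !mxE; set f := fun x => g i j x a b.
have df : differentiable (f \o chart_inv c' : _ -> C) ((c' \o chart_inv c) (c x)).
  by rewrite /= cK //; apply: transition_entry_differentiable.
have oD := chart_img_open (hc _ Ac) oc'.
have ffE : \forall y \near c x, (f \o chart_inv c) y =
    ((f \o chart_inv c') \o (c' \o chart_inv c)) y.
  apply: filterS (open_nbhs_nbhs (conj oD Dx)) => _ [z [zc zc'] <-] /=.
  by rewrite cK // cK'.
have dfc := transition_entry_differentiable a b Ac xc Ui Uj.
have dE := congr1 (@^~ y) (near_eq_diff ffE dfc).
have dC := congr1 (@^~ y) (diff_comp (dcc _ Dx) df).
by move: (etrans dE dC); rewrite /= cK.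
Qed.

Lemma cdifferentiable_mxprod m k (D : set 'rV[C]_n) (F : 'I_k -> 'rV[C]_n -> 'M[C]_M) :
  open D -> (forall l a b, cdifferentiable m D (fun y => F l y a b : C)) ->
  forall a b, cdifferentiable m D (fun y => (\prod_(l < k) F l y) a b : C).
Proof.
move=> oD; elim: k F => [|k IH] F cF a b.
  under eq_fun do rewrite big_ord0; exact: cdifferentiable_cst.
under eq_fun do rewrite big_ord_recl -mulmxE mxE.
apply: cdifferentiable_sum => // l; apply: cdifferentiableM => //.
by apply: (IH (fun l => F (lift ord0 l))).
Qed.

Lemma tform_holomorphic k (i : 'I_k.+1 -> J) :
  holomorphic_form (\bigcap_a U (i a)) (tform g i).
Proof.
split.
- move=> c x Ac [xc Ux]; split=> [v a r y z|v a b ab vab]; last first.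
    by rewrite tformE; exact: alt_trace_alternating ab vab.
  rewrite !tformE; apply: (@alt_trace_linear _ _ _ _ _ _ _ _ _ _ a).
  + move=> p q s u w; rewrite scalemxAr -mulmxDr; congr (_ *m _).
    by apply/matrixP => d e; rewrite !mxE linearP.
  + by rewrite /update eqxx.
  + by move=> b /negbTE ba; rewrite /update ba.
  + by move=> b /negbTE ba; rewrite /update ba.
- move=> c c' x v Ac Ac' [[xc xc'] Ux]; rewrite !tformE /alt_trace.
  apply: eq_bigr => s _; congr (_ * \tr _); rewrite /alt_prod.
  apply: eq_bigr => t _; congr (_ *: _); apply: eq_bigr => l _; congr (_ *m _).
  by apply: diff_mx_chart => //; exact: Ux.
move=> c v Ac m; have [hc _ _] := manifold_atlas X.
have [_ _ cK _ _] := hc _ Ac; set D := \bigcap_a U (i a).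
have oD : open D by apply: finite_bigcap_open => a; exact: oU.
have oW : open (c @` (chart_dom c `&` D)) by exact: chart_img_open (hc _ Ac) oD.
have cN p q y a b : D `<=` U p `&` U q -> cdifferentiable m (c @` (chart_dom c `&` D))
    (fun z => (invmx (g p q (chart_inv c z)) *m
               diff_mx p q c (chart_inv c z) y) a b : C).
  move=> DU.
  (* Writing the inverse of g_pq as g_qp spares a study of matrix inversion. *)
  have ext z : (c @` (chart_dom c `&` D)) z ->
      \sum_l g q p (chart_inv c z) a l *
             'd ((fun x => g p q x l b) \o chart_inv c : _ -> C) z y =
      (invmx (g p q (chart_inv c z)) *m diff_mx p q c (chart_inv c z) y) a b.
    move=> [x [xc /DU[xp xq]] <-]; rewrite !mxE cK // transition_inv //.
    by apply: eq_bigr => l _; rewrite mxE.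
  apply: (cdifferentiable_ext oW ext); apply: cdifferentiable_sum => // l.
  apply: cdifferentiableM => //.
    by apply: (transition_entry_holomorphic a l Ac oD) => z /DU[].
  (* The differential of g_pq costs one order, so holomorphy is used at order [m.+1]. *)
  by have [_] := transition_entry_holomorphic l b Ac oD DU m.+1; exact.
under eq_fun do rewrite tformE.
apply: cdifferentiable_sum => // s; apply: cdifferentiableM => //.
  exact: cdifferentiable_cst.
apply: cdifferentiable_sum => // a; under eq_fun do rewrite /alt_prod summxE.
apply: cdifferentiable_sum => // t; under eq_fun do rewrite mxE.
apply: cdifferentiableM => //; first exact: cdifferentiable_cst.
apply: cdifferentiable_mxprod => // l p q.
by apply: cN => z Dz; split; exact: Dz.
Qed.

End Transition.

(** * Change of trivialization *)

Lemma continuous_mx (T : topologicalType) (C : numFieldType) (p q : nat)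
    (f : T -> 'M[C]_(p, q)) (x : T) :
  (forall a b, {for x, continuous (fun y => f y a b : C)}) -> {for x, continuous f}.
Proof.
move=> cf; apply/cvg_mx_entourageP => A entA.
have cfA a b : \forall y \near x, A (f x a b, f y a b).
  by have /cvg_app_entourageP := cf a b; exact.
have H := filter_forall (nbhs_filter x) (fun a => filter_forall (nbhs_filter x) (cfA a)).
by apply: filterS H => y Ay a b; rewrite inE; exact: Ay.
Qed.

Section ChangeOfTrivialization.
Variables (C : numClosedFieldType) (n : nat) (X : complexManifold C n) (M : nat).
Variables (E : vectorBundle X M) (U U' : set X).
Variables (phi : trivialization E U) (psi : trivialization E U').

(** The matrix of phi psi^-1 on fibres, for a pair of trivializations that comes with no transition
    function. *)
Definition change_mx (z : X) : 'M[C]_M :=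
  \matrix_(a, b) (phi (triv_inv psi (z, delta_mx b 0))).2 a 0.

(** Linearity is given only for [triv_map], on vectors of [bundle_fiber]. Since [bundle_incl] is
    onto the fibre over [z], the points [triv_inv psi (z, w)] lift to such vectors, and the inverse
    of [psi] inherits linearity. *)
Lemma change_mxE z v : U z -> U' z ->
  phi (triv_inv psi (z, v)) = (z, change_mx z *m v).
Proof.
move=> Uz U'z; pose L w := (phi (triv_inv psi (z, w))).2.
have inclE w : exists e : bundle_fiber E z, bundle_incl e = triv_inv psi (z, w).
  have [pz _] := triv_invK psi w U'z.
  have : (range (@bundle_incl _ _ _ _ E z)) (triv_inv psi (z, w)).
    by rewrite bundle_incl_range.
  by case=> e _ <-; exists e.
have projE (e : bundle_fiber E z) : bundle_proj (bundle_incl e) = z.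
  have : (range (@bundle_incl _ _ _ _ E z)) (bundle_incl e) by exists e.
  by rewrite bundle_incl_range.
have linL : linear L.
  move=> r w1 w2; have [e1 E1] := inclE w1; have [e2 E2] := inclE w2.
  have E12 : triv_inv psi (z, r *: w1 + w2) = bundle_incl (r *: e1 + e2).
    rewrite -[RHS](triv_mapK psi) ?projE //; congr (triv_inv psi).
    rewrite [RHS]surjective_pairing triv_fst ?projE // triv_linear //.
    by rewrite E1 E2 (triv_invK psi w1 U'z).2 (triv_invK psi w2 U'z).2.
  by rewrite /L E12 triv_linear // E1 E2.
pose linM := GRing.isLinear.Build _ _ _ _ _ linL.
pose Llin : {linear 'cV[C]_M -> 'cV[C]_M} := HB.pack L linM.
rewrite [LHS]surjective_pairing; congr (_, _).
  by rewrite triv_fst (triv_invK psi v U'z).1.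
have -> : (phi (triv_inv psi (z, v))).2 = Llin v by [].
rewrite {1}[v]matrix_sum_delta linear_sum; apply/matrixP => a j; rewrite ord1 summxE mxE.
by apply: eq_bigr => b _; rewrite big_ord1 linearZ !mxE mulrC.
Qed.

Hypotheses (oU : open U) (oU' : open U').

Lemma triv_inv_slice_continuous z w : U' z ->
  {for z, continuous (fun x => triv_inv psi (x, w))}.
Proof.
move=> U'z; have [ci _] := triv_inv_holomorphic psi.
apply: (@continuous_comp _ _ _ (fun x : X => (x, w)) (triv_inv psi)); last first.
  by apply: ci; split.
by apply: (@cvg_pair _ _ _ (nbhs z) (nbhs z) (nbhs w)); [exact: cvg_id|exact: cvg_cst].
Qed.

Lemma change_mx_entry_continuous z a b : U z -> U' z ->
  {for z, continuous (fun x => change_mx x a b : C)}.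
Proof.
move=> Uz U'z; set w : 'cV[C]_M := delta_mx b 0.
rewrite (_ : (fun x => _) = (fun v : 'cV[C]_M => v a 0 : C) \o
    (snd \o (phi \o (fun x => triv_inv psi (x, w))))); last first.
  by apply/funext => x; rewrite /= mxE.
apply: continuous_comp; last exact: coord_continuous.
apply: continuous_comp; last exact: cvg_snd.
apply: continuous_comp; first exact: triv_inv_slice_continuous.
have [ct _] := triv_map_holomorphic phi; apply: ct.
by rewrite /preimage /= (triv_invK psi w U'z).1.
Qed.

(** Holomorphy of both trivializations is expressed in charts of [E]. Around each point a chart [d]
    of [E] is chosen, and the entry factors as a slice of psi^-1 read in [d], then phi read from
    [d], then a linear coordinate. *)
Lemma change_mx_entry_holomorphic (c : chart X 'rV[C]_n) m a b : atlas X c ->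
  cdifferentiable m (c @` (chart_dom c `&` (U `&` U')))
    (fun y => change_mx (chart_inv c y) a b : C).
Proof.
move=> Ac; set w : 'cV[C]_M := delta_mx b 0.
have [hcX _ _] := manifold_atlas X; have [hcE coverE _] := manifold_atlas E.
have [oc _ cK _ _] := hcX _ Ac.
pose sec x := triv_inv psi (x, w).
have sec_proj x : U' x -> bundle_proj (sec x) = x.
  by move=> U'x; exact: (triv_invK psi w U'x).1.
apply: cdifferentiable_local => _ [x0 [x0c [x0U x0U']] <-].
have [d Ad x0d] := coverE (sec x0); have [od _ dK _ _] := hcE _ Ad.
(* The part of the overlap where the section [sec] stays in the domain of [d]. *)
pose D1 := U `&` U' `&` sec @^-1` chart_dom d.
have oD1 : open D1.
  rewrite openE => z [[Uz U'z] zd]; apply: filterI.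
    exact: (open_nbhs_nbhs (conj (openI oU oU') (conj Uz U'z))).
  have cs : sec @ z --> sec z := triv_inv_slice_continuous (w := w) U'z.
  by apply: cs; exact: open_nbhs_nbhs.
have oO1 := chart_img_open (hcX _ Ac) oD1.
exists (c @` (chart_dom c `&` D1)); first by exists x0.
pose pc := Chart (chart_dom c `*` setT) (fun p : X * 'cV[C]_M => (c p.1, p.2))
             (fun q => (chart_inv c q.1, q.2)).
have Apc : prod_atlas (atlas X) 'cV[C]_M pc by exists c.
pose F y : 'rV[C]_(n + M) := (d \o triv_inv psi \o chart_inv pc) (y, w).
have cF : cdifferentiable m (c @` (chart_dom c `&` D1)) F.
  have [_ /(_ pc d Apc Ad m)] := triv_inv_holomorphic psi.
  apply: cdifferentiable_slice oO1 _ => _ [x [xc [[Ux U'x] xd]] <-].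
  by exists (x, w).
(* Restricting to [chart_dom c] keeps the values of [phi] in the domain of the product chart
   [pc]. *)
pose B := @bundle_proj _ _ _ _ E @^-1` (U `&` chart_dom c).
have oB : open B.
  rewrite openE => e Be; have [cp _] := bundle_proj_holomorphic E.
  by apply: (cp e I); exact: (open_nbhs_nbhs (conj (openI oU oc) Be)).
have oD2 := chart_img_open (hcE _ Ad) oB.
pose G u : 'rV[C]_n * 'cV[C]_M := (pc \o phi \o chart_inv d) u.
have cG : cdifferentiable m (d @` (chart_dom d `&` B)) G.
  have [_ /(_ d pc Ad Apc m)] := triv_map_holomorphic phi.
  apply: cdifferentiable_sub => _ [e [ed [Ue ec]] <-].
  by exists e => //; do 2?split => //; rewrite /= triv_fst.
have linS : linear (fun q : 'rV[C]_n * 'cV[C]_M => q.2 a 0 : C^o).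
  by move=> r q1 q2; rewrite /= !mxE.
pose linM := GRing.isLinear.Build _ _ _ _ _ linS.
pose S : {linear ('rV[C]_n * 'cV[C]_M)%type -> C} :=
  HB.pack (fun q : 'rV[C]_n * 'cV[C]_M => q.2 a 0) linM.
have cS : continuous S.
  move=> q; apply: (@continuous_comp _ _ _ snd (fun v : 'cV[C]_M => v a 0 : C)).
    exact: cvg_snd.
  exact: coord_continuous.
have cSG := cdifferentiable_lin oD2 cS cG.
apply: (cdifferentiable_ext oO1 _ (cdifferentiable_comp oO1 _ cF cSG)).
  move=> _ [x [xc [[Ux U'x] xd]] <-].
  by rewrite /F /G /= cK // dK // mxE.
move=> _ [x [xc [[Ux U'x] xd]] <-]; exists (sec x).
  by split=> //; rewrite /B /preimage /= sec_proj.
by rewrite /F /= cK.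
Qed.

Lemma change_mx_holomorphic :
  holomorphic_map (atlas X) (space_atlas 'M[C]_M) (U `&` U') change_mx.
Proof.
split=> [x [Ux U'x]|c _ Ac -> m].
  by apply: continuous_mx => a b; apply: change_mx_entry_continuous.
have [hc _ _] := manifold_atlas X; rewrite setIT.
apply: cdifferentiable_mx => [|a b].
  exact: (chart_img_open (hc _ Ac) (openI oU oU')).
exact: change_mx_entry_holomorphic.
Qed.

End ChangeOfTrivialization.

(** * Cohomology classes *)

Section DoubledCover.
Variables (C : numClosedFieldType) (n : nat) (X : complexManifold C n) (M : nat).
Variables (E : vectorBundle X M) (J : Type) (U : J -> set X).
Hypothesis oU : forall j, open (U j).
Variables (phi phi' : forall j, trivialization E (U j)).
Variables (g g' : J -> J -> X -> 'M[C]_M).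
Hypothesis phig : transition_functions phi g.
Hypothesis phig' : transition_functions phi' g'.

Definition double_triv (p : J * bool) : trivialization E (U p.1) :=
  if p.2 then phi' p.1 else phi p.1.

(** For equal labels the given [g] or [g'] is kept, so that each copy of the index set recovers its
    own system by computation. *)
Definition double_transition (p q : J * bool) : X -> 'M[C]_M :=
  if p.2 == q.2 then (if p.2 then g' else g) p.1 q.1
  else change_mx (double_triv p) (double_triv q).

(** The change of trivialization in the other direction is the inverse. *)
Lemma change_mx_unit (V V' : set X) (f : trivialization E V)
    (f' : trivialization E V') z :
  V z -> V' z -> change_mx f f' z \in unitmx.
Proof.
move=> Vz V'z; suff /mulmx1_unit[] : change_mx f f' z *m change_mx f' f z = 1%:M by [].
apply/trmx_inj/row_matrixP => s; rewrite -!tr_col; congr (_^T).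
rewrite !colE -mulmxA; set v := delta_mx s 0.
have := change_mxE f f' (change_mx f' f z *m v) Vz V'z.
rewrite -(change_mxE f' f v) // triv_mapK ?(triv_invK f v Vz).1 //.
by rewrite (triv_invK f v Vz).2 mul1mx => -[].
Qed.

Lemma double_transitionP : transition_functions double_triv double_transition.
Proof.
have changeP p q :
    holomorphic_map (atlas X) (space_atlas 'M[C]_M) (U p.1 `&` U q.1)
      (change_mx (double_triv p) (double_triv q)) /\
    forall z, (U p.1 `&` U q.1) z ->
      change_mx (double_triv p) (double_triv q) z \in unitmx /\
      forall v, double_triv p (triv_inv (double_triv q) (z, v)) =
                (z, change_mx (double_triv p) (double_triv q) z *m v).
  split; first exact: change_mx_holomorphic.
  by move=> z [Up Uq]; split=> [|v]; [exact: change_mx_unit|exact: change_mxE].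
move=> [i a] [j b]; move: (changeP (i, a) (j, b)).
by rewrite /double_transition /double_triv /=; case: a; case: b.
Qed.

End DoubledCover.

(** * Restriction and linear combinations of holomorphic forms *)

Lemma holomorphic_form_sub (C : numClosedFieldType) (n : nat) (X : complexManifold C n)
    (k : nat) (U V : set X) (w : kform X k) :
  V `<=` U -> holomorphic_form U w -> holomorphic_form V w.
Proof.
move=> VU [aw cw hw]; split=> [c x Ac [xc /VU xU]|c c' x v Ac Ac' [cc' /VU xU]|].
- by apply: aw.
- by apply: cw.
move=> c v Ac m; apply: cdifferentiable_sub (hw c v Ac m) => _ [x [xc /VU xU] <-].
by exists x.
Qed.

Section HolomorphicForms.
Variables (C : numClosedFieldType) (n : nat) (X : complexManifold C n) (k : nat).
Variables (U : set X).
Hypothesis oU : open U.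

Lemma holomorphic_form_linear (r : C) (w w' : kform X k) :
  holomorphic_form U w -> holomorphic_form U w' ->
  holomorphic_form U (fun c x v => r * w c x v + w' c x v).
Proof.
move=> [aw cw hw] [aw' cw' hw']; split.
- move=> c x Ac xU; have [mw alw] := aw c x Ac xU; have [mw' alw'] := aw' c x Ac xU.
  split=> [v a s y z|v a b ab vab].
    by rewrite mw mw' !mulrDr [r * (s * _)]mulrCA addrACA.
  by rewrite (alw _ _ _ ab vab) (alw' _ _ _ ab vab) mulr0 addr0.
- by move=> c c' x v Ac Ac' xU; rewrite (cw c c') // (cw' c c').
move=> c v Ac m; have [hc _ _] := manifold_atlas X.
have oW := chart_img_open (hc _ Ac) oU.
apply: cdifferentiableD => //; last exact: hw'.
by apply: cdifferentiableM => //; [exact: cdifferentiable_cst|exact: hw].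
Qed.

Lemma holomorphic_form0 : holomorphic_form U (kform0 X k).
Proof.
split=> // [c x _ _|c v _ m]; last exact: cdifferentiable_cst.
by split=> // v a r y z; rewrite /kform0 mulr0 addr0.
Qed.

Lemma holomorphic_form_sum (J : Type) (r : seq J) (e : J -> C) (w : J -> kform X k) :
  (forall j, holomorphic_form U (w j)) ->
  holomorphic_form U (fun c x v => \sum_(j <- r) e j * w j c x v).
Proof.
move=> hw; elim: r => [|j r IH].
  rewrite (_ : (fun _ => _) = kform0 X k); first exact: holomorphic_form0.
  by apply/funext => c; apply/funext => x; apply/funext => v; rewrite big_nil.
rewrite (_ : (fun _ => _) = fun c x v =>
    e j * w j c x v + \sum_(j <- r) e j * w j c x v).
  exact: holomorphic_form_linear.
by apply/funext => c; apply/funext => x; apply/funext => v; rewrite big_cons.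
Qed.

End HolomorphicForms.

(** A cochain bounding t - s becomes one bounding t - s' on subtracting [b]; adding [b] goes
    back. *)
Lemma cech_class_eq (C : numClosedFieldType) (n : nat) (X : complexManifold C n)
    (disp : Order.disp_t) (I : orderType disp) (U : I -> set X) (k p : nat)
    (s s' : cochain X I k p.+1) (b : cochain X I k p) :
  (forall i, open (U i)) -> is_cochain U b ->
  cochain_eq U (fun i => kform_sub (s' i) (s i)) (cech_diff b) ->
  cech_class U s = cech_class U s'.
Proof.
move=> oU hb sb.
have diffE (e : C) (b1 b2 : cochain X I k p) i c x v :
    cech_diff (fun i c x v => e * b1 i c x v + b2 i c x v) i c x v =
    e * cech_diff b1 i c x v + cech_diff b2 i c x v.
  rewrite /cech_diff mulr_sumr -big_split; apply: eq_bigr => j _ /=.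
  by rewrite mulrDr mulrCA.
have coch (e : C) (b1 b2 : cochain X I k p) : is_cochain U b1 -> is_cochain U b2 ->
    is_cochain U (fun i c x v => e * b1 i c x v + b2 i c x v).
  move=> h1 h2 i inc; apply: holomorphic_form_linear; [|exact: h1|exact: h2].
  by apply: finite_bigcap_open => a; exact: oU.
apply/seteqP; split=> t [ct [b' hb' tb']]; split=> //.
  exists (fun i c x v => -1 * b i c x v + b' i c x v); first exact: coch.
  move=> i inc c x v Ac xc; rewrite diffE -(tb' i inc c x v Ac xc) -(sb i inc c x v Ac xc).
  by rewrite /kform_sub; ring.
exists (fun i c x v => 1 * b i c x v + b' i c x v); first exact: coch.
move=> i inc c x v Ac xc; rewrite diffE -(tb' i inc c x v Ac xc) -(sb i inc c x v Ac xc).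
by rewrite /kform_sub; ring.
Qed.

Theorem theorem1p1 (R : realType) (n : nat) (X : complexManifold R[i]%C n)
    (M : nat) (E : vectorBundle X M)
    (disp : Order.disp_t) (I : orderType disp) (U : I -> set X)
    (hU : is_open_cover U) (k : nat) (hk : (0 < k)%N) :
  (forall g : I -> I -> X -> 'M[R[i]%C]_M, transition_system E U g ->
     [/\ forall i : 'I_k.+1 -> I,
           holomorphic_form (cover_meet U i) (tform g i),
         is_cocycle U (fhat k g)
       & cech_cohomology U (cech_class U (fhat k g))]) /\
  (forall g g' : I -> I -> X -> 'M[R[i]%C]_M,
     transition_system E U g -> transition_system E U g' ->
     cech_class U (fhat k g) = cech_class U (fhat k g')).
Proof.
have oU : forall i, open (U i) by case: hU.
split=> [g [phi phig]|g g' [phi phig] [phi' phig']].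
  have hol (i : 'I_k.+1 -> I) : holomorphic_form (cover_meet U i) (tform g i).
    exact: (tform_holomorphic phig oU i).
  have coc : is_cocycle U (fhat k g).
    split=> [i _|i _ c x v Ac [xc Ux]]; first exact: hol.
    by apply: (tform_cocycle phig oU) => // a; exact: Ux.
  by split=> //; exists (fhat k g).
(* The cochain to be constructed has one Cech degree less, so [k] is made a successor. *)
case: k hk => [hk|k _].
  by exfalso; move: hk; rewrite ltnn.
have phiG := double_transitionP oU phig phig'.
set G := double_transition _ _ _ _ in phiG.
have oU2 (p : I * bool) : open (U p.1) by [].
(* The prism operator applied to the cochain of the doubled cover; its differential is t' - t. *)
pose b : cochain X I k.+1 k := fun i c x v =>
  \sum_(j < k.+1) (-1) ^+ j * tform G (prism j i) c x v.
apply: (cech_class_eq (b := b) oU) => [i _|i _ c x v Ac [xc Ux]].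
  rewrite /b; apply: (holomorphic_form_sum (U := cover_meet U i)).
    by apply: finite_bigcap_open => a; exact: oU.
  move=> j; have := tform_holomorphic phiG oU2 (prism j i).
  (* The open sets of a prism simplex are among those of [i], so their intersection contains
     [cover_meet U i]. *)
  by apply: holomorphic_form_sub => x Ux a _; exact: Ux.
rewrite /cech_diff /b /kform_sub.
have := @prism_homotopy _ _ _ (fun e => tform G e c x v) i.
move=> <- //.
move=> e ei; apply: (tform_cocycle phiG oU2) => // a.
by have [p ->] := ei a; exact: Ux.
Qed.
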